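(* Let $\Omega\subset\mathbb{R}^n$ be a (bounded) QH-visibility domain. Then $\Omega$ is quasihyperbolically well behaved if and only if $\Omega$ has no geodesic loop in $\overline{\Omega}^{Euc}$.
   Context: For a domain $\Omega\subsetneq\mathbb{R}^n$, $\partial_{Euc}\Omega$ and $\overline{\Omega}^{Euc}$ are its Euclidean boundary and closure, and $\delta_\Omega(x)=d_{Euc}(x,\partial_{Euc}\Omega)$. The quasihyperbolic metric is $k_\Omega(x,y)=\inf_\gamma\int_\gamma\frac{|dx|}{\delta_\Omega(x)}$, the infimum over rectifiable curves in $\Omega$ joining $x$ and $y$; $(\Omega,k_\Omega)$ is a complete, proper, geodesic metric space. A quasihyperbolic geodesic (geodesic line) is a geodesic (line) of $(\Omega,k_\Omega)$. For a curve $\gamma$, $k_\Omega(x_0,\gamma)$ denotes the $k_\Omega$-distance from $x_0$ to the image of $\gamma$. A bounded domain $\Omega$ is a QH-visibility domain if for every pair $p,q\in\partial_{Euc}\Omega$, $p\neq q$, there exist neighborhoods $U$ of $p$ and $V$ of $q$ in $\mathbb{R}^n$ with $\overline U\cap\overline V=\emptyset$ and a compact set $K\subset\Omega$ such that every quasihyperbolic geodesic $\gamma:[0,T]\to\Omega$ with $\gamma(0)\in U$ and $\gamma(T)\in V$ satisfies $\gamma([0,T])\cap K\neq\emptyset$. A bounded domain $\Omega\subset\mathbb{R}^n$ is quasihyperbolically well behaved if, whenever $\{x_k\},\{y_k\}$ are sequences in $\Omega$ with $\lim_{k}x_k=\lim_k y_k=p\in\partial_{Euc}\Omega$ and $\gamma_k:[a_k,b_k]\to\Omega$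 is a sequence of quasihyperbolic geodesics joining $x_k$ and $y_k$, one has $\lim_{k\to\infty}k_\Omega(x_0,\gamma_k)=\infty$ for some (hence all) $x_0\in\Omega$. For a quasihyperbolic geodesic line $\gamma:(-\infty,\infty)\to\Omega$, let $\Gamma^{\infty}_\gamma$ (resp. $\Gamma^{-\infty}_\gamma$) be the set of $x\in\overline{\Omega}^{Euc}$ for which there is a sequence $t_k\to\infty$ (resp. $t_k\to-\infty$) with $\gamma(t_k)\to x$. The line $\gamma$ is a geodesic loop in $\overline{\Omega}^{Euc}$ if $\Gamma^{\infty}_\gamma=\Gamma^{-\infty}_\gamma$; $\Omega$ has no geodesic loop in $\overline{\Omega}^{Euc}$ if no quasihyperbolic geodesic line in $\Omega$ is such a loop. *)

(* Defs.v *)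
From HB Require Import structures.
From mathcomp Require Import all_boot all_order all_algebra.
From mathcomp Require Import all_classical all_reals all_analysis.

Set Implicit Arguments.
Unset Strict Implicit.
Unset Printing Implicit Defensive.

Import Order.TTheory GRing.Theory Num.Theory.
Import numFieldNormedType.Exports.

Local Open Scope classical_set_scope.
Local Open Scope ring_scope.

(* Points of R^n are row vectors. The library norm on 'rV[R]_n is the sup norm:
   it gives the Euclidean topology and the Euclidean bounded sets, so library
   topology is used throughout, but distances and lengths need [enorm]. *)
Section quasihyperbolic.
Context {R : realType} {n : nat}.
Implicit Types (Omega : set 'rV[R]_n) (x y p q : 'rV[R]_n).
Implicit Types (gamma : R -> 'rV[R]_n) (a b : R).

Definition enorm x : R := Num.sqrt (\sum_(i < n) x ord0 i ^+ 2).

Definition euc_boundary Omega : set 'rV[R]_n := closure Omega `\` Omega°.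

(* [Omega <> setT] also rules out n = 0. *)
Definition bounded_domain Omega :=
  [/\ open Omega, connected Omega, Omega !=set0, Omega <> setT
    & bounded_set Omega].

Definition delta Omega x : R :=
  inf [set enorm (x - y) | y in euc_boundary Omega].

(* A partition of [a, b] omits its first point a, see [itv_partition]. *)
Definition curve_length gamma a b : \bar R :=
  ereal_sup [set (\sum_(0 <= i < size s)
      enorm (gamma (nth b (a :: s) i.+1) - gamma (nth b (a :: s) i)))%:E
    | s in itv_partition a b].

Definition rectifiable_curve_in Omega gamma a b :=
  [/\ a <= b,
      {within `[a, b], continuous gamma},
      (forall t, t \in `[a, b] -> Omega (gamma t))
    & (curve_length gamma a b < +oo)%E].

(* Arc length parametrization, on [0, l] where l is the length of gamma:
   s is sent to gamma t, with t the first time at which the length of gamma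
   over [a, t] reaches s. *)
Definition arc_param gamma a b (s : R) : 'rV[R]_n :=
  gamma (inf [set t | t \in `[a, b] /\ (s%:E <= curve_length gamma a t)%E]).

(* The line integral of 1 / delta along gamma with respect to arc length. *)
Definition qh_length Omega gamma a b : \bar R :=
  (\int[lebesgue_measure]_(s in `[0%R, fine (curve_length gamma a b)])
     ((delta Omega (arc_param gamma a b s))^-1)%:E)%E.

Definition qh_dist Omega x y : \bar R :=
  ereal_inf [set v | exists gamma a b,
    [/\ rectifiable_curve_in Omega gamma a b, gamma a = x, gamma b = y
      & v = qh_length Omega gamma a b]].

Definition qh_geodesic Omega gamma a b :=
  [/\ a <= b,
      (forall t, t \in `[a, b] -> Omega (gamma t))
    & (forall s t, s \in `[a, b] -> t \in `[a, b] ->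
        qh_dist Omega (gamma s) (gamma t) = `|s - t|%:E)].

Definition qh_geodesic_line Omega gamma :=
  (forall t, Omega (gamma t)) /\
  (forall s t, qh_dist Omega (gamma s) (gamma t) = `|s - t|%:E).

Definition qh_dist_curve Omega x gamma a b : \bar R :=
  ereal_inf [set qh_dist Omega x (gamma t) | t in `[a, b]].

Definition qh_visibility_domain Omega :=
  bounded_domain Omega /\
  forall p q, euc_boundary Omega p -> euc_boundary Omega q -> p <> q ->
  exists U V K : set 'rV[R]_n,
    [/\ nbhs p U, nbhs q V, closure U `&` closure V = set0,
        compact K /\ K `<=` Omega
      & forall gamma (T : R), qh_geodesic Omega gamma 0 T ->
          U (gamma 0) -> V (gamma T) -> (gamma @` `[0, T]) `&` K !=set0].

Definition qh_well_behaved Omega :=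
  forall (x y : nat -> 'rV[R]_n) p (a b : nat -> R)
         (gamma : nat -> R -> 'rV[R]_n),
    (forall k, Omega (x k)) -> (forall k, Omega (y k)) ->
    euc_boundary Omega p ->
    x @ \oo --> p -> y @ \oo --> p ->
    (forall k, [/\ qh_geodesic Omega (gamma k) (a k) (b k),
                   gamma k (a k) = x k & gamma k (b k) = y k]) ->
  exists2 x0, Omega x0 &
    qh_dist_curve Omega x0 (gamma k) (a k) (b k) @[k --> \oo] --> +oo%E.

Definition limit_set_pinfty Omega gamma : set 'rV[R]_n :=
  [set x | closure Omega x /\
    exists2 t : nat -> R, t @ \oo --> +oo & gamma (t k) @[k --> \oo] --> x].

Definition limit_set_ninfty Omega gamma : set 'rV[R]_n :=
  [set x | closure Omega x /\
    exists2 t : nat -> R, t @ \oo --> -oo & gamma (t k) @[k --> \oo] --> x].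

Definition geodesic_loop Omega gamma :=
  qh_geodesic_line Omega gamma /\
  limit_set_pinfty Omega gamma = limit_set_ninfty Omega gamma.

Definition no_geodesic_loop Omega :=
  forall gamma, ~ geodesic_loop Omega gamma.

End quasihyperbolic.

(* Main.v *)
Require Import Defs.
From HB Require Import structures.
From mathcomp Require Import all_boot all_order all_algebra.
From mathcomp Require Import all_classical all_reals all_analysis.
From mathcomp Require Import measurable_realfun ring lra.

(** The statement concerns only the distance [qh_dist], through four of its
    properties on a bounded domain: the triangle inequality
    [qh_dist_triangle]; the fact that Euclidean-near points of the domain are
    near in this distance [near_qh_dist_lt]; finiteness [qh_dist_fin]; and the
    lower bound [ln (delta x / delta y)] of [qh_dist_ge_ln], which makes balls
    relatively compact in the domain [qh_bounded_ultra_cvg]. These come from the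
    additivity of arc length and of the line integral of [1 / delta].

    A geodesic line has limit points at both ends, by compactness of the closure,
    and they lie on the boundary. If the line is a loop, choose times going to
    [+oo] and to [-oo] along which it tends to the same [p]. The subarcs between
    these times all pass through [gamma 0], so a loop contradicts good behaviour.

    Conversely let geodesics [g k] have both end points tending to [p] while
    infinitely many of them contain a point [g k (c k)] within a fixed distance
    of [x0]. Fix an ultrafilter concentrated on these indices. Since the end
    points escape to infinity for this distance, the recentred geodesics
    [t |-> g k (t + c k)] are eventually defined at every [t], and properness
    gives a pointwise limit [gamma t] in the domain. Distances pass to the limit
    [qh_dist_cvg], so [gamma] is a geodesic line; the ultrafilter dispenses with
    equicontinuity and with the extraction of subsequences. Visibility, applied
    to the part of [g k] between a point near [gamma t] for large [t] and its
    end point near [p], shows that [p] is the only limit point of [gamma] at each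
    end [visible_limit_end]; hence [gamma] is a loop. *)

Set Implicit Arguments.
Unset Strict Implicit.
Unset Printing Implicit Defensive.

Import Order.TTheory GRing.Theory Num.Theory.
Import numFieldNormedType.Exports.

Local Open Scope classical_set_scope.
Local Open Scope ring_scope.

(** * The Euclidean norm and the distance to the boundary *)

Section enorm.
Context {R : realType} {n : nat}.
Implicit Types x y : 'rV[R]_n.

Lemma enorm_ge0 x : 0 <= enorm x.
Proof. exact: sqrtr_ge0. Qed.

Lemma enorm_sqr x : enorm x ^+ 2 = \sum_(i < n) x ord0 i ^+ 2.
Proof. by rewrite sqr_sqrtr// sumr_ge0// => i _; rewrite sqr_ge0. Qed.

Lemma enormN x : enorm (- x) = enorm x.
Proof. by congr Num.sqrt; apply: eq_bigr => i _; rewrite mxE sqrrN. Qed.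

Lemma enormB x y : enorm (x - y) = enorm (y - x).
Proof. by rewrite -enormN opprB. Qed.

Lemma enormZ (c : R) x : enorm (c *: x) = `|c| * enorm x.
Proof.
rewrite -sqrtr_sqr -sqrtrM ?sqr_ge0// mulr_sumr; congr Num.sqrt.
by apply: eq_bigr => i _; rewrite mxE exprMn.
Qed.

Lemma enorm0 : enorm (0 : 'rV[R]_n) = 0.
Proof. by rewrite -(scale0r 0) enormZ normr0 mul0r. Qed.

Lemma enorm_eq0 x : enorm x = 0 -> x = 0.
Proof.
move=> x0; apply/rowP => i; rewrite mxE.
have : \sum_(i < n) x ord0 i ^+ 2 == 0 by rewrite -enorm_sqr x0 expr0n.
rewrite psumr_eq0; last by move=> j _; rewrite sqr_ge0.
by move=> /allP/(_ i (mem_index_enum i)); rewrite sqrf_eq0 => /eqP.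
Qed.

Lemma cauchy_schwarz x y :
  \sum_(i < n) x ord0 i * y ord0 i <= enorm x * enorm y.
Proof.
have [/eqP|x0] := boolP (enorm x == 0).
  move=> /enorm_eq0 ->; rewrite enorm0 mul0r big1// => i _.
  by rewrite mxE mul0r.
have [/eqP|y0] := boolP (enorm y == 0).
  move=> /enorm_eq0 ->; rewrite enorm0 mulr0 big1// => i _.
  by rewrite mxE mulr0.
have xp : 0 < enorm x by rewrite lt_def x0 enorm_ge0.
have yp : 0 < enorm y by rewrite lt_def y0 enorm_ge0.
set A := enorm x; set B := enorm y; set S := \sum_(i < n) _.
have : 0 <= \sum_(i < n) (B * x ord0 i - A * y ord0 i) ^+ 2.
  by rewrite sumr_ge0// => i _; rewrite sqr_ge0.
have -> : \sum_(i < n) (B * x ord0 i - A * y ord0 i) ^+ 2 =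
    B ^+ 2 * (\sum_(i < n) x ord0 i ^+ 2)
    + A ^+ 2 * (\sum_(i < n) y ord0 i ^+ 2) - 2 * A * B * S.
  rewrite /S !mulr_sumr -big_split -sumrB/=.
  by apply: eq_bigr => i _; ring.
rewrite -!enorm_sqr -/A -/B.
have AB0 : 0 < A * B by rewrite mulr_gt0.
move=> h; rewrite -(ler_pM2l AB0); nra.
Qed.

Lemma enormD x y : enorm (x + y) <= enorm x + enorm y.
Proof.
rewrite -(ler_pXn2r (ltn0Sn 1))// ?nnegrE ?addr_ge0 ?enorm_ge0//.
rewrite enorm_sqr sqrrD !enorm_sqr.
have -> : \sum_(i < n) (x + y) ord0 i ^+ 2 = \sum_(i < n) x ord0 i ^+ 2 +
    (\sum_(i < n) x ord0 i * y ord0 i) *+ 2 + \sum_(i < n) y ord0 i ^+ 2.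
  rewrite -sumrMnl -!big_split/=; apply: eq_bigr => i _.
  by rewrite mxE sqrrD.
by rewrite lerD2r lerD2l lerMn2r cauchy_schwarz orbT.
Qed.

Lemma enormB_triangle x y z : enorm (x - z) <= enorm (x - y) + enorm (y - z).
Proof. by apply: le_trans (enormD _ _); rewrite addrA subrK. Qed.

(** The topology comes from the sup norm while distances are Euclidean; the two
    norms are equivalent by this bound and the next one. *)
Lemma norm_le_enorm x : `|x| <= enorm x.
Proof.
rewrite [leLHS]/Num.norm/= mx_normrE; apply/bigmax_leP; split => [|[i j] _].
  exact: enorm_ge0.
rewrite /= ord1 -(ler_pXn2r (ltn0Sn 1)) ?nnegrE ?normr_ge0 ?enorm_ge0//.
rewrite enorm_sqr real_normK ?num_real// (bigD1 j)//= lerDl.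
by rewrite sumr_ge0// => k _; rewrite sqr_ge0.
Qed.

Lemma enorm_le_norm x : enorm x <= n%:R * `|x|.
Proof.
rewrite -(ler_pXn2r (ltn0Sn 1)) ?nnegrE ?mulr_ge0 ?enorm_ge0 ?ler0n//.
rewrite enorm_sqr exprMn.
apply: (@le_trans _ _ (\sum_(i < n) `|x| ^+ 2)); last first.
  rewrite sumr_const card_ord -[leLHS]mulr_natl ler_wpM2r ?sqr_ge0//.
  by rewrite -natrX ler_nat; case: n => // m; rewrite leq_pmulr.
apply: ler_sum => i _; rewrite -[x _ _ ^+ 2]real_normK ?num_real//.
rewrite ler_pXn2r ?nnegrE//.
rewrite [leRHS]/Num.norm/= mx_normrE; apply/bigmax_geP; right.
by exists (ord0, i).
Qed.

Lemma near_enorm_lt x (e : R) : 0 < e -> \forall y \near x, enorm (x - y) < e.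
Proof.
move=> e0; have n0 : 0 < n.+1%:R :> R by rewrite ltr0n.
apply/nbhs_ballP; exists (e / n.+1%:R) => [|y]; first by rewrite /= divr_gt0.
rewrite -ball_normE/= ltr_pdivlMr// => xy.
apply: le_lt_trans (enorm_le_norm _) _.
by apply: le_lt_trans xy; rewrite mulrC ler_wpM2l// ler_nat.
Qed.

Lemma enorm_lipschitz_continuous (f : 'rV[R]_n -> R) :
  (forall x y, `|f x - f y| <= enorm (x - y)) -> continuous f.
Proof.
move=> fL x A /nbhs_ballP[e /= e0 eA].
apply: filterS (near_enorm_lt x e0) => y xy; apply: eA.
by rewrite -ball_normE/= (le_lt_trans (fL _ _)).
Qed.

End enorm.

Section delta.
Context {R : realType} {n : nat}.
Variable Omega : set 'rV[R]_n.
Implicit Types x y p : 'rV[R]_n.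

Let distances x : set R := [set enorm (x - y) | y in euc_boundary Omega].

Let distances_lbound x : lbound (distances x) 0.
Proof. by move=> _ [y _ <-]; exact: enorm_ge0. Qed.

Lemma delta_le x p : euc_boundary Omega p -> delta Omega x <= enorm (x - p).
Proof.
move=> bp; apply: ge_inf; last by exists p.
by exists 0; exact: distances_lbound.
Qed.

Lemma le_delta x (r : R) : euc_boundary Omega !=set0 ->
  (forall p, euc_boundary Omega p -> r <= enorm (x - p)) -> r <= delta Omega x.
Proof.
move=> [p bp] rx; apply: lb_le_inf; first by exists (enorm (x - p)), p.
by move=> _ [q bq <-]; exact: rx.
Qed.

Lemma delta_empty x : ~ (euc_boundary Omega !=set0) -> delta Omega x = 0.
Proof.
move=> b0; rewrite /delta (_ : [set _ | _ in _] = set0) ?inf0//.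
by apply/seteqP; split=> [z [y yb _]|//]; case: b0; exists y.
Qed.

Lemma delta_ge0 x : 0 <= delta Omega x.
Proof.
have [b0|b0] := pselect (euc_boundary Omega !=set0).
  by apply: le_delta => // p _; exact: enorm_ge0.
by rewrite delta_empty.
Qed.

Lemma delta_le_add x y : delta Omega x <= enorm (x - y) + delta Omega y.
Proof.
have [b0|b0] := pselect (euc_boundary Omega !=set0); last first.
  by rewrite !delta_empty// addr0 enorm_ge0.
rewrite -lerBlDl; apply: le_delta => // p bp.
rewrite lerBlDl; apply: le_trans (enormB_triangle _ y _).
exact: delta_le.
Qed.

Lemma delta_continuous : continuous (delta Omega).
Proof.
apply: enorm_lipschitz_continuous => x y.
have := delta_le_add x y; have := delta_le_add y x.
rewrite (enormB y) ler_norml; lra.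
Qed.

Lemma euc_boundary_open : open Omega ->
  euc_boundary Omega = closure Omega `\` Omega.
Proof. by move=> /interior_id oO; rewrite /euc_boundary oO. Qed.

(** If the boundary is empty then [delta] vanishes and so does its inverse, so
    the bound needs no case distinction where it is used. *)
Lemma near_delta_inv_bound x : open Omega -> Omega x ->
  exists2 r : R, 0 < r &
    ball x r `<=` Omega /\ forall y, ball x r y -> (delta Omega y)^-1 <= r^-1.
Proof.
move=> oO Ox; have /nbhs_ballP[e /= e0 xeO] : nbhs x Omega.
  exact: open_nbhs_nbhs.
have e20 : 0 < e / 2 by rewrite divr_gt0.
exists (e / 2) => //; split => [y xy|y xy].
  by apply: xeO; apply: le_ball xy; lra.
have [b0|b0] := pselect (euc_boundary Omega !=set0); last first.
  by rewrite delta_empty// invr0 invr_ge0 ltW.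
have yd : e / 2 <= delta Omega y.
  apply: le_delta => // p; rewrite euc_boundary_open// => -[_ Op].
  rewrite leNgt; apply/negP => yp; apply: Op; apply: xeO.
  rewrite (splitr e); apply: ball_triangle xy _.
  by rewrite -ball_normE/= (le_lt_trans (norm_le_enorm _)).
by rewrite lef_pV2// posrE (lt_le_trans e20).
Qed.

Lemma delta_gt0 x : open Omega -> euc_boundary Omega !=set0 -> Omega x ->
  0 < delta Omega x.
Proof.
move=> oO b0 Ox; have [r r0 [xrO _]] := near_delta_inv_bound oO Ox.
apply: lt_le_trans (r0) _; apply: le_delta => // p.
rewrite euc_boundary_open// => -[_ Op].
rewrite leNgt; apply/negP => xp; apply: Op; apply: xrO.
by rewrite -ball_normE/= (le_lt_trans (norm_le_enorm _)).
Qed.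

End delta.

(** * Length of curves *)

Section curve_length.
Context {R : realType} {n : nat}.
Implicit Types (gamma eta : R -> 'rV[R]_n) (a b c : R) (s t : seq R).

(** The recursive form supports induction on the partition, and does not
    mention the right end point. *)
Fixpoint chord_sum gamma a s : R :=
  if s is x :: t then enorm (gamma x - gamma a) + chord_sum gamma x t else 0.

Lemma chord_sumE gamma a b s :
  \sum_(0 <= i < size s)
      enorm (gamma (nth b (a :: s) i.+1) - gamma (nth b (a :: s) i)) =
  chord_sum gamma a s.
Proof.
elim: s a => [a|x t IH a]; first by rewrite big_nil.
by rewrite /= big_nat_recl//= -IH.
Qed.

Lemma curve_lengthE gamma a b : curve_length gamma a b =
  ereal_sup [set (chord_sum gamma a s)%:E | s in itv_partition a b].
Proof.
by congr ereal_sup; apply: eq_imagel => s _; rewrite chord_sumE.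
Qed.

Lemma chord_sum_cat gamma a b s t : itv_partition a b s ->
  chord_sum gamma a (s ++ t) = chord_sum gamma a s + chord_sum gamma b t.
Proof.
elim: s a => [a /itv_partition_nil ->|x s IH a /itv_partition_cons xs] /=.
  by rewrite add0r.
by rewrite IH// addrA.
Qed.

Lemma chord_sum_le_length gamma a b s : itv_partition a b s ->
  ((chord_sum gamma a s)%:E <= curve_length gamma a b)%E.
Proof.
by move=> abs; rewrite curve_lengthE; apply: ereal_sup_ubound; exists s.
Qed.

Lemma chord_le_length gamma a b : a <= b ->
  ((enorm (gamma b - gamma a))%:E <= curve_length gamma a b)%E.
Proof.
rewrite le_eqVlt => /predU1P[<-|ab].
  by rewrite subrr enorm0 (chord_sum_le_length gamma (s := [::])).
have := chord_sum_le_length gamma (itv_partition1 ab).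
by rewrite /= addr0.
Qed.

Lemma curve_length_ge0 gamma a b : a <= b -> (0 <= curve_length gamma a b)%E.
Proof.
move=> ab; apply: le_trans (chord_le_length gamma ab).
by rewrite lee_fin enorm_ge0.
Qed.

Lemma curve_length_prepend gamma a b c : a <= b -> b <= c ->
  ((enorm (gamma b - gamma a))%:E + curve_length gamma b c <=
   curve_length gamma a c)%E.
Proof.
rewrite le_eqVlt => /predU1P[<-|ab bc]; first by rewrite subrr enorm0 add0e.
rewrite -leeBrDl// [leLHS]curve_lengthE; apply: ge_ereal_sup => _ [s bs <-].
rewrite leeBrDl// -EFinD; apply: (chord_sum_le_length gamma (s := b :: s)).
by case: bs => bs bsc; split => //=; rewrite ab.
Qed.

(** A partition of [[a, c]] need not pass through [b]: the chord that jumps over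
    [b] is replaced by the two chords through [gamma b]. Conversely partitions
    of the two halves concatenate. *)
Lemma curve_lengthD gamma a b c : a <= b -> b <= c ->
  curve_length gamma a c = (curve_length gamma a b + curve_length gamma b c)%E.
Proof.
move=> ab bc; apply/eqP; rewrite eq_le; apply/andP; split.
  rewrite [leLHS]curve_lengthE; apply: ge_ereal_sup => _ [s acs <-].
  elim: s a ab acs => [a ab acs|x s IH a ab acs].
    by rewrite /= adde_ge0// curve_length_ge0.
  have xcs := itv_partition_cons acs.
  have ax : a < x by case: acs => /= /andP[].
  have [xb|bx] := leP x b; rewrite /= EFinD.
    apply: (@le_trans _ _ ((enorm (gamma x - gamma a))%:E +
      (curve_length gamma x b + curve_length gamma b c))%E).
      by rewrite leeD2l// IH.
    by rewrite addeA leeD2r// curve_length_prepend// ltW.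
  apply: (@le_trans _ _ ((enorm (gamma b - gamma a))%:E +
      (chord_sum gamma b (x :: s))%:E)%E).
    rewrite /= -!EFinD lee_fin addrA lerD2r addrC; exact: enormB_triangle.
  apply: leeD; first exact: chord_le_length.
  apply: chord_sum_le_length; case: acs => /= /andP[_ xs] sc.
  by split => //=; rewrite bx.
rewrite [curve_length gamma a b]curve_lengthE.
have [bcoo|bcoo] := eqVneq (curve_length gamma b c) +oo%E.
  rewrite (@le_trans _ _ +oo%E)// ?leey// -bcoo.
  apply: le_trans (curve_length_prepend gamma ab bc).
  by rewrite leeDr// lee_fin enorm_ge0.
have bcf : curve_length gamma b c \is a fin_num.
  by rewrite ge0_fin_numE ?curve_length_ge0// lt_neqAle bcoo leey.
rewrite -leeBrDr//; apply: ge_ereal_sup => _ [s abs <-].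
rewrite leeBrDr// -leeBrDl// [leLHS]curve_lengthE.
apply: ge_ereal_sup => _ [t bct <-].
rewrite leeBrDl// -EFinD -(chord_sum_cat _ _ abs).
exact/chord_sum_le_length/(itv_partition_cat abs bct).
Qed.

Lemma curve_length_le gamma a b c : a <= b -> b <= c ->
  (curve_length gamma a b <= curve_length gamma a c)%E.
Proof.
by move=> ab bc; rewrite (curve_lengthD _ ab bc) leeDl// curve_length_ge0.
Qed.

Lemma eq_curve_length gamma eta a b :
  (forall u, u \in `[a, b] -> gamma u = eta u) ->
  curve_length gamma a b = curve_length eta a b.
Proof.
move=> ge; rewrite !curve_lengthE; congr ereal_sup; apply: eq_imagel => s.
elim: s a ge => //= x s IH a ge axs; congr EFin.
have xbs := itv_partition_cons axs.
have ax : a < x by case: axs => /= /andP[].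
have xb : x <= b := itv_partition_le xbs.
rewrite !ge ?in_itv/= ?lexx ?xb ?(le_trans (ltW ax))// ?ltW//.
congr +%R; apply: EFin_inj; apply: IH => // u; rewrite in_itv/= => /andP[xu ub].
by rewrite ge// in_itv/= ub (le_trans (ltW ax)).
Qed.

Lemma curve_length_shift gamma (h : R) a b :
  curve_length (fun w => gamma (w + h)) a b =
  curve_length gamma (a + h) (b + h).
Proof.
have le1 eta (k u v : R) :
    (curve_length (fun w : R => eta (w + k)%R) u v <=
     curve_length eta (u + k)%R (v + k)%R)%E.
  rewrite [leLHS]curve_lengthE; apply: ge_ereal_sup => _ [s uvs <-].
  have -> : chord_sum (fun w : R => eta (w + k)%R) u s =
      chord_sum eta (u + k) (map (fun w : R => w + k) s).
    by elim: s u {uvs} => //= x s IH u; rewrite IH.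
  apply: chord_sum_le_length; case: uvs => us /eqP usv; split.
    by elim: s u us {usv} => //= x s IH u /andP[ux xs]; rewrite ltrD2r ux IH.
  by rewrite -usv (last_map (fun w : R => w + k)).
apply/eqP; rewrite eq_le le1/=.
have := le1 (fun w : R => gamma (w + h)) (- h) (a + h) (b + h).
rewrite !addrK; apply: le_trans; rewrite (@eq_curve_length _ gamma)// => u _.
by rewrite subrK.
Qed.

Lemma curve_length_line (x v : 'rV[R]_n) a b : a <= b ->
  (curve_length (fun w => x + w *: v)%R a b <= ((b - a) * enorm v)%:E)%E.
Proof.
move=> ab; rewrite curve_lengthE; apply: ge_ereal_sup => _ [s + <-].
elim: s a ab => [a ab _|y s IH a ab ays] /=.
  by rewrite lee_fin mulr_ge0 ?subr_ge0// enorm_ge0.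
have ysb := itv_partition_cons ays.
have ay : a < y by case: ays => /= /andP[].
have := IH _ (itv_partition_le ysb) ysb; rewrite !lee_fin => IHy.
rewrite opprD addrACA subrr add0r -scalerBl enormZ gtr0_norm ?subr_gt0//.
rewrite [b - a](_ : _ = (y - a) + (b - y)); last by ring.
by rewrite [leRHS]mulrDl lerD2l.
Qed.

End curve_length.

(** * Translation invariance of the Lebesgue integral *)

Section lebesgue_translation.
Context {R : realType}.
Local Open Scope ereal_scope.

Lemma lebesgue_measure_shift (h : R) (A : set (measurableTypeR R)) :
  measurable A ->
  lebesgue_measure ((fun x : R => (x - h)%R) @^-1` A) = lebesgue_measure A.
Proof.
have mh : measurable_fun [set: measurableTypeR R]
    ((fun x => x - h)%R : measurableTypeR R -> measurableTypeR R).
  by apply: measurable_funB.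
pose phi_mixin := isMeasurableFun.Build _ _ _ _ _ mh.
pose phi : {mfun measurableTypeR R >-> measurableTypeR R} :=
  HB.pack (fun x : R => (x - h)%R) phi_mixin.
move=> mA; apply/esym.
apply: (@lebesgue_measure_unique R (pushforward (@lebesgue_measure R) phi)) => // X.
move=> [[u v] _ <-] /=; rewrite /pushforward.
rewrite (_ : _ @^-1` _ = `](u + h)%R, (v + h)%R]%classic); last first.
  by apply/seteqP; split => x /=; rewrite !in_itv/= ltrBrDr lerBlDr.
rewrite !lebesgue_measure_itv/= !lte_fin ltrD2r.
by case: ifP => // _; rewrite -!EFinD; congr EFin; ring.
Qed.

(** Puts the arc length parameter of the second of two consecutive curves back
    to the origin. *)
Lemma ge0_integral_shift (h : R) (D : set (measurableTypeR R))
    (f : R -> \bar R) :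
  measurable D -> measurable_fun D f -> (forall x, D x -> 0 <= f x) ->
  \int[lebesgue_measure]_(x in (fun x => (x - h)%R) @^-1` D) f (x - h)%R =
  \int[lebesgue_measure]_(x in D) f x.
Proof.
move=> mD mf f0.
have mh : measurable_fun [set: measurableTypeR R]
    ((fun x => x - h)%R : measurableTypeR R -> measurableTypeR R).
  by apply: measurable_funB.
have := @ge0_integral_pushforward _ _ _ _ R _ mh lebesgue_measure D f mD mf.
move=> <-; last by move=> y; rewrite inE; exact: f0.
by apply: eq_measure_integral => A mA _; exact: lebesgue_measure_shift.
Qed.

End lebesgue_translation.

(** * Arc length parametrization *)

Section arc_length.
Context {R : realType} {n : nat}.
Implicit Types (gamma eta : R -> 'rV[R]_n) (a b c s t u : R).

Lemma within_continuous_enorm gamma a b t (e : R) :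
  {within `[a, b], continuous gamma} -> t \in `[a, b] -> 0 < e ->
  exists2 d : R, 0 < d &
    forall u, u \in `[a, b] -> `|t - u| < d -> enorm (gamma t - gamma u) < e.
Proof.
move=> cg tab e0.
have := cg t _ (near_enorm_lt (gamma t) e0).
have tab' : `[a, b]%classic t by [].
rewrite /nbhs/= -(nbhs_subspace_in tab') => /nbhs_ballP[d /= d0 dB].
by exists d => // u uab tu; apply: dB => //; rewrite -ball_normE.
Qed.

(** The parameters by which the curve has run through length [s]; [arc_param]
    evaluates the curve at their infimum. *)
Definition arc_times gamma a b s : set R :=
  [set t | t \in `[a, b] /\ (s%:E <= curve_length gamma a t)%E].

Definition arc_time gamma a b s : R := inf (arc_times gamma a b s).

Lemma arc_paramE gamma a b s :
  arc_param gamma a b s = gamma (arc_time gamma a b s).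
Proof. by []. Qed.

Lemma arc_times_lbound gamma a b s : lbound (arc_times gamma a b s) a.
Proof. by move=> t [+ _]; rewrite in_itv/= => /andP[]. Qed.

Lemma arc_times_end gamma a b s : a <= b ->
  (s%:E <= curve_length gamma a b)%E -> arc_times gamma a b s b.
Proof. by move=> ab sL; split => //; rewrite in_itv/= ab lexx. Qed.

Lemma arc_time_le gamma a b s t : arc_times gamma a b s t ->
  arc_time gamma a b s <= t.
Proof. by move=> st; apply: ge_inf => //; exists a; exact: arc_times_lbound. Qed.

Lemma arc_time_itv gamma a b s : a <= b ->
  (s%:E <= curve_length gamma a b)%E -> arc_time gamma a b s \in `[a, b].
Proof.
move=> ab sL; rewrite in_itv/= arc_time_le ?andbT; last exact: arc_times_end.
by apply: lb_le_inf; [exists b; exact: arc_times_end|exact: arc_times_lbound].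
Qed.

(** The infimum defining [arc_time] may fail to be attained when arc length is
    not known to be continuous, but any later time has length at least [s]. *)
Lemma arc_time_lt gamma a b s t : a <= b ->
  (s%:E <= curve_length gamma a b)%E ->
  arc_time gamma a b s < t -> t <= b -> (s%:E <= curve_length gamma a t)%E.
Proof.
move=> ab sL st tb.
have h : has_inf (arc_times gamma a b s).
  by split; [exists b; exact: arc_times_end|exists a; exact: arc_times_lbound].
have [u su ut] : exists2 u, arc_times gamma a b s u & u < t.
  have e0 : 0 < t - arc_time gamma a b s by rewrite subr_gt0.
  have [u su ut] := inf_adherent e0 h; exists u => //.
  by move: ut; rewrite /arc_time subrKC.
case: su => + sLu; rewrite in_itv/= => /andP[au _].
by apply: le_trans sLu _; apply: curve_length_le; rewrite // ltW.
Qed.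

(** At times just after [arc_time] the remaining length is at most [L - s] and
    bounds the chord to the end point; continuity of the curve carries this
    over to [arc_time] itself. *)
Lemma arc_param_end gamma a b s : a <= b ->
  {within `[a, b], continuous gamma} -> curve_length gamma a b \is a fin_num ->
  (s%:E <= curve_length gamma a b)%E ->
  enorm (arc_param gamma a b s - gamma b) <= fine (curve_length gamma a b) - s.
Proof.
move=> ab cg Lf sL; rewrite arc_paramE; set t := arc_time _ _ _ _.
have tab : t \in `[a, b] by exact: arc_time_itv.
have [at_ tb] : a <= t /\ t <= b by apply/andP; rewrite in_itv/= in tab.
have sL' : s <= fine (curve_length gamma a b) by rewrite -lee_fin fineK.
have [->|tb'] := eqVneq t b; first by rewrite subrr enorm0 subr_ge0.
have {}tb' : t < b by rewrite lt_neqAle tb'.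
apply/ler_addgt0Pr => e e0.
have [d d0 dB] := within_continuous_enorm cg tab e0.
pose u := Num.min b (t + d / 2).
have tu : t < u by rewrite lt_min tb' ltrDl divr_gt0.
have ub : u <= b by rewrite ge_min lexx.
have au : a <= u by rewrite (le_trans at_)// ltW.
have ud : u <= t + d / 2 by rewrite ge_min lexx orbT.
have tud : `|t - u| < d by rewrite ltr0_norm ?subr_lt0//; lra.
have := dB u; rewrite in_itv/= au ub => /(_ isT tud) tue.
have sLu := arc_time_lt ab sL tu ub.
have Lub := chord_le_length gamma ub.
apply: le_trans (enormB_triangle _ (gamma u) _) _.
rewrite [leLHS]addrC; apply: lerD; last exact: ltW.
rewrite enormB. rewrite lerBrDr -lee_fin EFinD fineK//.
by rewrite (curve_lengthD gamma au ub) addeC leeD.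
Qed.

Lemma arc_time_prefix gamma a b c s : a <= b -> b <= c ->
  (s%:E <= curve_length gamma a b)%E ->
  arc_time gamma a c s = arc_time gamma a b s.
Proof.
move=> ab bc sL; have sLc := le_trans sL (curve_length_le gamma ab bc).
apply/eqP; rewrite eq_le; apply/andP; split.
  apply: lb_le_inf; first by exists b; exact: arc_times_end.
  move=> t [+ sLt]; rewrite in_itv/= => /andP[at_ tb].
  by apply: arc_time_le; split => //; rewrite in_itv/= at_ (le_trans tb).
apply: lb_le_inf; first by exists c; apply: arc_times_end => //; exact: le_trans bc.
move=> t [+ sLt]; rewrite in_itv/= => /andP[at_ tc].
have [tb|bt] := leP t b.
  by apply: arc_time_le; split => //; rewrite in_itv/= at_ tb.
by apply: le_trans (ltW bt); apply: arc_time_le; exact: arc_times_end.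
Qed.

Lemma arc_time_suffix gamma a b c s : a <= b -> b <= c ->
  curve_length gamma a b \is a fin_num ->
  fine (curve_length gamma a b) < s ->
  arc_time gamma a c s =
  arc_time gamma b c (s - fine (curve_length gamma a b)).
Proof.
move=> ab bc Lf Ls; congr inf; apply/seteqP; split => t [+ st];
  rewrite in_itv/= => /andP[t1 t2].
  have bt : b <= t.
    rewrite leNgt; apply/negP => tb.
    have := le_trans st (curve_length_le gamma t1 (ltW tb)).
    by rewrite -[leRHS]fineK// lee_fin leNgt Ls.
  split; first by rewrite in_itv/= bt t2.
  rewrite EFinB fineK// leeBlDl//.
  by move: st; rewrite (curve_lengthD gamma ab bt).
split; first by rewrite in_itv/= t2 (le_trans ab).
rewrite (curve_lengthD gamma ab t1); move: st.
by rewrite EFinB fineK// leeBlDl.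
Qed.

Lemma eq_arc_time gamma eta a b s :
  (forall u, u \in `[a, b] -> gamma u = eta u) ->
  arc_time gamma a b s = arc_time eta a b s.
Proof.
move=> ge; congr inf; apply/seteqP; split => t [tab];
  move: (tab); rewrite in_itv/= => /andP[_ tb] st; split => //.
  rewrite -(@eq_curve_length _ _ gamma)// => u; rewrite in_itv/= => /andP[au ut].
  by rewrite ge// in_itv/= au (le_trans ut).
rewrite (@eq_curve_length _ _ gamma eta)// => u; rewrite in_itv/= => /andP[au ut].
by rewrite ge// in_itv/= au (le_trans ut).
Qed.

Lemma arc_param_shift gamma (h : R) a b s : a <= b ->
  (s%:E <= curve_length gamma (a + h)%R (b + h)%R)%E ->
  arc_param (fun t => gamma (t + h)) a b s = arc_param gamma (a + h) (b + h) s.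
Proof.
move=> ab sL; rewrite !arc_paramE; congr gamma.
have sL' : (s%:E <= curve_length (fun t => gamma (t + h)%R) a b)%E.
  by rewrite curve_length_shift.
apply/eqP; rewrite eq_le -lerBrDr; apply/andP; split.
  rewrite lerBrDr; apply: lb_le_inf.
    by exists (b + h); apply: arc_times_end; rewrite // lerD2r.
  move=> t [+ st]; rewrite in_itv/= => /andP[at_ tb].
  rewrite -lerBrDr; apply: arc_time_le; split.
    by rewrite in_itv/= lerBrDr lerBlDr at_.
  by rewrite curve_length_shift subrK.
rewrite -lerBlDr; apply: lb_le_inf; first by exists b; exact: arc_times_end.
move=> t [+ st]; rewrite in_itv/= => /andP[at_ tb].
rewrite lerBlDr; apply: arc_time_le; split.
  by rewrite in_itv/= !lerD2r at_.
by rewrite -curve_length_shift.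
Qed.

(** [arc_time] is monotone where it is meaningful, but drops to the junk value
    [inf set0] beyond the total length; allowing the end point [b] at every [s]
    gives a globally monotone, hence measurable, extension. *)
Lemma arc_time_measurable gamma a b : a <= b ->
  curve_length gamma a b \is a fin_num ->
  exists2 tau : R -> R, measurable_fun setT tau &
    forall s, s \in `[0, fine (curve_length gamma a b)] ->
      tau s = arc_time gamma a b s.
Proof.
move=> ab Lf.
pose T s : set R := [set t | t \in `[a, b] /\
  (t = b \/ (s%:E <= curve_length gamma a t)%E)].
have Tb s : T s b by split; [rewrite in_itv/= ab lexx|left].
have Ta s : lbound (T s) a by move=> t [+ _]; rewrite in_itv/= => /andP[].
exists (fun s => inf (T s)).
  apply: nondecreasing_measurable => // s s' ss'.
  apply: lb_le_inf; first by exists b.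
  move=> t [tab Tt]; apply: ge_inf; first by exists a.
  split => //; case: Tt => [tb|s't]; [by left|right].
  by apply: le_trans s't; rewrite lee_fin.
move=> s; rewrite in_itv/= => /andP[s0 sL]; congr inf.
apply/seteqP; split => t [tab]; last by move=> st; split => //; right.
by case=> [->|//]; apply: arc_times_end => //; rewrite -[leRHS]fineK// lee_fin.
Qed.

End arc_length.

(** * Quasihyperbolic length *)

Section qh_length.
Context {R : realType} {n : nat}.
Variable Omega : set 'rV[R]_n.
Implicit Types (gamma eta : R -> 'rV[R]_n) (a b c s t u : R).

(** A continuous function of a monotone one. The inverse is written as the power
    of exponent -1, which is measurable on the whole line. *)
Lemma qh_density_measurable gamma a b : a <= b ->
  {within `[a, b], continuous gamma} -> curve_length gamma a b \is a fin_num ->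
  measurable_fun `[0, fine (curve_length gamma a b)]
    (fun s => ((delta Omega (arc_param gamma a b s))^-1)%:E).
Proof.
move=> ab cg Lf; have [tau mtau tauE] := arc_time_measurable ab Lf.
apply/measurable_EFinP.
apply: (eq_measurable_fun (fun s => (delta Omega (gamma (tau s))) `^ (-1))).
  move=> s; rewrite inE => sL.
  by rewrite powR_inv1 ?delta_ge0// arc_paramE tauE.
apply: (measurableT_comp (measurable_powR _)).
have mdg : measurable_fun `[a, b] (delta Omega \o gamma).
  apply: subspace_continuous_measurable_fun => //.
  move=> t; apply: (@continuous_comp _ _ _ (gamma : subspace `[a, b] -> _)).
    exact: cg.
  exact: delta_continuous.
apply: (measurable_comp (F := `[a, b]%classic) _ _ mdg) => //.
  move=> _ [s sL <-]; rewrite /= tauE//; apply: arc_time_itv => //.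
  by move: sL; rewrite /= in_itv/= => /andP[_]; rewrite -lee_fin fineK.
exact: measurable_funS mtau.
Qed.

Lemma qh_length_ge0 gamma a b : (0 <= qh_length Omega gamma a b)%E.
Proof. by apply: integral_ge0 => s _; rewrite lee_fin invr_ge0 delta_ge0. Qed.

Lemma eq_qh_length gamma eta a b : a <= b ->
  (forall u, u \in `[a, b] -> gamma u = eta u) ->
  curve_length gamma a b \is a fin_num ->
  qh_length Omega gamma a b = qh_length Omega eta a b.
Proof.
move=> ab ge Lf; rewrite /qh_length (eq_curve_length ge).
apply: eq_integral => s; rewrite inE/= in_itv/= => /andP[_ sL].
rewrite !arc_paramE -(eq_arc_time _ ge) ge//; apply: arc_time_itv => //.
by rewrite -[leRHS]fineK// lee_fin (eq_curve_length ge).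
Qed.

Lemma qh_length_shift gamma (h : R) a b : a <= b ->
  curve_length gamma (a + h) (b + h) \is a fin_num ->
  qh_length Omega (fun t => gamma (t + h)) a b =
  qh_length Omega gamma (a + h) (b + h).
Proof.
move=> ab Lf; rewrite /qh_length curve_length_shift.
apply: eq_integral => s; rewrite inE/= in_itv/= => /andP[_ sL].
by rewrite arc_param_shift// -[leRHS]fineK// lee_fin.
Qed.

Lemma qh_length_le gamma a b (C : R) : a <= b ->
  {within `[a, b], continuous gamma} -> curve_length gamma a b \is a fin_num ->
  (forall t, t \in `[a, b] -> (delta Omega (gamma t))^-1 <= C) ->
  (qh_length Omega gamma a b <= C%:E * curve_length gamma a b)%E.
Proof.
move=> ab cg Lf dC; set L := fine (curve_length gamma a b).
have L0 : 0 <= L by rewrite fine_ge0// curve_length_ge0.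
have C0 : 0 <= C.
  by apply: le_trans (dC a _); rewrite ?invr_ge0 ?delta_ge0// in_itv/= lexx.
apply: (@le_trans _ _ (\int[lebesgue_measure]_(s in `[0%R, L]) (cst C%:E) s)%E).
  apply: ge0_le_integral => //=.
  - by move=> s _; rewrite lee_fin invr_ge0 delta_ge0.
  - exact: qh_density_measurable.
  - move=> s; rewrite in_itv/= => /andP[_ sL]; rewrite lee_fin arc_paramE dC//.
    by apply: arc_time_itv => //; rewrite -[leRHS]fineK// lee_fin.
rewrite integral_cst//= lebesgue_measure_itv/= lte_fin.
have [L0'|] := ltP 0 L; first by rewrite sube0 fineK.
by rewrite mule0 mule_ge0// curve_length_ge0.
Qed.

(** The arc length parametrization of the concatenation runs through that of the
    first half on [[0, L1]] and through that of the second, delayed by [L1], on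
    [(L1, L1 + L2]]. *)
Lemma qh_length_cat gamma a b c : a <= b -> b <= c ->
  {within `[a, c], continuous gamma} -> curve_length gamma a c \is a fin_num ->
  (qh_length Omega gamma a c <=
   qh_length Omega gamma a b + qh_length Omega gamma b c)%E.
Proof.
move=> ab bc cg Lf.
have cg1 : {within `[a, b], continuous gamma}.
  by apply: continuous_subspaceW cg; apply: subset_itvl; rewrite bnd_simp.
have cg2 : {within `[b, c], continuous gamma}.
  by apply: continuous_subspaceW cg; apply: subset_itvr; rewrite bnd_simp.
have Lac := curve_lengthD gamma ab bc.
have [Lf1 Lf2] : curve_length gamma a b \is a fin_num /\
    curve_length gamma b c \is a fin_num.
  by move: Lf; rewrite Lac fin_numD => /andP[].
have := qh_density_measurable (le_trans ab bc) cg Lf.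
have Lfine : fine (curve_length gamma a c) =
    fine (curve_length gamma a b) + fine (curve_length gamma b c).
  by rewrite Lac fineD.
rewrite [X in (X <= _)%E]/qh_length Lfine => mf.
set L1 := fine (curve_length gamma a b).
set L2 := fine (curve_length gamma b c).
rewrite -/L1 -/L2 in mf.
have L10 : 0 <= L1 by rewrite fine_ge0// curve_length_ge0.
have L20 : 0 <= L2 by rewrite fine_ge0// curve_length_ge0.
have split_itv : `[0, L1 + L2]%classic =
    `[0, L1]%classic `|` `]L1, L1 + L2]%classic.
  by rewrite -itv_bndbnd_setU// bnd_simp// lerDl.
rewrite split_itv.
rewrite (@ge0_integral_setU _ _ _ lebesgue_measure
  `[0, L1]%classic `]L1, L1 + L2]%classic); first last.
- rewrite disj_set2E; apply/eqP/seteqP; split => // s [].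
  by rewrite /= !in_itv/= => /andP[_ sL1] /andP[/lt_le_trans/(_ sL1)]; rewrite ltxx.
- by move=> s _; rewrite lee_fin invr_ge0 delta_ge0.
- by rewrite -split_itv.
- exact: measurable_itv.
- exact: measurable_itv.
have sub2 : `]0, L2]%classic `<=` `[0, L2]%classic.
  by apply: subset_itvr; rewrite bnd_simp.
apply: leeD.
  rewrite le_eqVlt; apply/orP; left; apply/eqP.
  apply: eq_integral => s; rewrite inE/= in_itv/= => /andP[s0 sL].
  by rewrite !arc_paramE (arc_time_prefix ab bc)// -[leRHS]fineK// lee_fin.
have m2 := qh_density_measurable bc cg2 Lf2.
apply: (@le_trans _ _ (\int[lebesgue_measure]_(s in `]0%R, L2])
     ((delta Omega (arc_param gamma b c s))^-1)%:E)%E); last first.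
  apply: ge0_subset_integral => //.
  by move=> s _; rewrite lee_fin invr_ge0 delta_ge0.
have shiftE := @ge0_integral_shift _ L1 `]0, L2]%classic
  (fun s => ((delta Omega (arc_param gamma b c s))^-1)%:E).
rewrite -shiftE; [|exact: measurable_itv|exact: measurable_funS m2|
  by move=> s _; rewrite lee_fin invr_ge0 delta_ge0].
rewrite (_ : _ @^-1` _ = `]L1, L1 + L2]%classic); last first.
  by apply/seteqP; split => s /=; rewrite !in_itv/= subr_gt0 lerBlDl.
rewrite le_eqVlt; apply/orP; left; apply/eqP.
apply: eq_integral => s; rewrite inE/= in_itv/= => /andP[s0 sL].
by rewrite !arc_paramE (arc_time_suffix ab bc).
Qed.

(** At arc length [s] the curve is within [L - s] of its end point, so the
    density there is at least [1 / (d + L - s)], with [d] the value of [delta]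
    at the end. Integrating gives [ln ((d + L) / d)], and [d + L] is at least
    the value of [delta] at the start. *)
Lemma qh_length_ge_ln gamma a b : a <= b ->
  {within `[a, b], continuous gamma} -> curve_length gamma a b \is a fin_num ->
  (forall t, t \in `[a, b] -> 0 < delta Omega (gamma t)) ->
  ((ln (delta Omega (gamma a) / delta Omega (gamma b)))%:E <=
   qh_length Omega gamma a b)%E.
Proof.
move=> ab cg Lf dt0.
have da0 : 0 < delta Omega (gamma a) by rewrite dt0// in_itv/= lexx.
have d0 : 0 < delta Omega (gamma b) by rewrite dt0// in_itv/= ab lexx.
set L := fine (curve_length gamma a b).
set d := delta Omega (gamma b).
have L0 : 0 <= L by rewrite fine_ge0// curve_length_ge0.
have daL : delta Omega (gamma a) <= d + L.
  apply: le_trans (delta_le_add _ _ (gamma b)) _; rewrite addrC lerD2l enormB.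
  by rewrite -lee_fin fineK// chord_le_length.
apply: (@le_trans _ _ (ln ((d + L) / d))%:E).
  have dL0 : 0 < d + L by rewrite (lt_le_trans da0).
  by rewrite lee_fin ler_ln ?posrE ?divr_gt0// ler_pM2r// invr_gt0.
have [L0'|] := ltP 0 L; last first.
  move=> L0'; rewrite (_ : L = 0); last by apply/eqP; rewrite eq_le L0 L0'.
  by rewrite addr0 divff ?gt_eqF// ln1 qh_length_ge0.
have dpos s : s <= L -> 0 < d + L - s.
  by rewrite -addrA => sL; rewrite ltr_wpDr// subr_ge0.
pose F s := - ln (d + L - s).
have dF s : s <= L -> is_derive s 1 F (d + L - s)^-1.
  move=> sL; have dln := is_derive1_ln (dpos _ sL).
  have dlin : is_derive s 1 (fun u : R => d + L - u) (-1).
    by apply: is_derive_eq; rewrite add0r mul1r.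
  have dcomp : is_derive s 1 (@ln R \o (fun u : R => d + L - u))
      ((d + L - s)^-1 * -1).
    exact: is_derive1_comp.
  by have := is_deriveN dcomp; rewrite mulrN1 opprK.
have cF s : s <= L -> {for s, continuous F}.
  move=> /dF ?; apply/differentiable_continuous/derivable1_diffP.
  exact: ex_derive.
have cf : {within `[0, L], continuous (fun s => (d + L - s)^-1)}.
  apply: continuous_in_subspaceT => s; rewrite inE/= in_itv/= => /andP[_ sL].
  apply: cvgV; first by rewrite gt_eqF// dpos.
  by apply: cvgB; [exact: cvg_cst|exact: cvg_id].
have FTC : (\int[lebesgue_measure]_(s in `[0%R, L]) ((d + L - s)^-1)%:E =
    (F L)%:E - (F 0)%:E)%E.
  apply: continuous_FTC2 => //.
  split.
  - by move=> s; rewrite in_itv/= => /andP[_ /ltW/dF ?]; exact: ex_derive.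
  - by apply: cvg_at_right_filter; exact: cF.
  - by apply: cvg_at_left_filter; exact: cF.
  - by move=> s; rewrite in_itv/= => /andP[_ /ltW/dF ?]; rewrite derive1E derive_val.
have -> : (ln ((d + L) / d))%:E =
    (\int[lebesgue_measure]_(s in `[0%R, L]) ((d + L - s)^-1)%:E)%E.
  rewrite FTC /F -EFinB; congr EFin.
  rewrite ln_div ?posrE ?addr_gt0// subr0 addrK opprK.
  by rewrite addrC.
apply: ge0_le_integral => //=.
- move=> s; rewrite in_itv/= => /andP[_ sL].
  by rewrite lee_fin invr_ge0; exact: ltW (dpos _ sL).
- apply/measurable_EFinP.
  apply: subspace_continuous_measurable_fun; [exact: measurable_itv|exact: cf].
- exact: qh_density_measurable.
- move=> s; rewrite in_itv/= => /andP[s0 sL]; rewrite lee_fin arc_paramE.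
  have sL' : (s%:E <= curve_length gamma a b)%E by rewrite -[leRHS]fineK// lee_fin.
  have tab := arc_time_itv ab sL'.
  rewrite lef_pV2 ?posrE ?dpos ?dt0//.
  apply: le_trans (delta_le_add _ _ (gamma b)) _.
  rewrite addrC -addrA lerD2l; exact: arc_param_end.
Qed.

End qh_length.

(** * Quasihyperbolic distance *)

Section qh_dist.
Context {R : realType} {n : nat}.
Variable Omega : set 'rV[R]_n.
Implicit Types (gamma eta : R -> 'rV[R]_n) (a b c s t u : R).
Implicit Types x y z p : 'rV[R]_n.

Lemma rectifiable_fin gamma a b : rectifiable_curve_in Omega gamma a b ->
  curve_length gamma a b \is a fin_num.
Proof. by move=> [ab _ _ Loo]; rewrite ge0_fin_numE// curve_length_ge0. Qed.

Lemma rectifiable_shift gamma (h : R) a b :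
  rectifiable_curve_in Omega gamma (a + h) (b + h) ->
  rectifiable_curve_in Omega (fun t => gamma (t + h)) a b.
Proof.
move=> [ab cg Og Loo]; split.
- by move: ab; rewrite lerD2r.
- apply/subspace_continuousP => t /= tab W gW.
  have tab' : `[a + h, b + h]%classic (t + h).
    by move: tab; rewrite /= !in_itv/= !lerD2r.
  have /subspace_continuousP/(_ _ tab' _ gW) := cg.
  move=> /nbhs_ballP[d /= d0 dB]; apply/nbhs_ballP; exists d => //= u tu uab.
  apply: dB; last by move: uab; rewrite /= !in_itv/= !lerD2r.
  by move: tu; rewrite -!ball_normE/= opprD addrACA subrr addr0.
- by move=> t tab; apply: Og; move: tab; rewrite !in_itv/= !lerD2r.
- by rewrite curve_length_shift.
Qed.

Definition glue gamma eta b t := if t <= b then gamma t else eta t.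

Lemma glue_left gamma eta a b t : t \in `[a, b] -> gamma t = glue gamma eta b t.
Proof. by rewrite in_itv/= /glue => /andP[_ ->]. Qed.

Lemma glue_right gamma eta b c t : gamma b = eta b ->
  t \in `[b, c] -> eta t = glue gamma eta b t.
Proof.
move=> ge; rewrite in_itv/= /glue => /andP[bt _]; case: ifPn => // tb.
by rewrite (_ : t = b)//; apply/eqP; rewrite eq_le tb bt.
Qed.

Lemma rectifiable_glue gamma eta a b c : gamma b = eta b ->
  rectifiable_curve_in Omega gamma a b -> rectifiable_curve_in Omega eta b c ->
  rectifiable_curve_in Omega (glue gamma eta b) a c.
Proof.
move=> ge [ab cg Og Lg] [bc ce Oe Le]; split.
- exact: le_trans bc.
- have -> : `[a, c]%classic = `[a, b]%classic `|` `[b, c]%classic.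
    apply/seteqP; split => t /=; rewrite !in_itv/=.
      by move=> /andP[-> ->]; rewrite andbT/=; apply/orP; exact: le_total.
    by move=> [/andP[-> tb]|/andP[bt ->]]; rewrite ?(le_trans tb)// (le_trans ab).
  apply: withinU_continuous; try exact: interval_closed.
    apply: (subspace_eq_continuous _ cg) => t; rewrite inE; exact: glue_left.
  apply: (subspace_eq_continuous _ ce) => t; rewrite inE; exact: glue_right.
- move=> t; rewrite in_itv/= => /andP[at_ tc]; have [tb|bt] := leP t b.
    have tab : t \in `[a, b] by rewrite in_itv/= at_ tb.
    by rewrite -(glue_left gamma eta tab); exact: Og.
  have tbc : t \in `[b, c] by rewrite in_itv/= tc ltW.
  by rewrite -(glue_right ge tbc); exact: Oe.
- rewrite (curve_lengthD _ ab bc) -(eq_curve_length (@glue_left gamma eta a b)).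
  by rewrite -(eq_curve_length (fun t => @glue_right _ _ _ c t ge)) lte_add_pinfty.
Qed.

Lemma qh_dist_ge0 x y : (0 <= qh_dist Omega x y)%E.
Proof.
apply: le_ereal_inf_tmp => _ [gamma [a [b [_ _ _ ->]]]]; exact: qh_length_ge0.
Qed.

Lemma qh_dist_le_length gamma a b : rectifiable_curve_in Omega gamma a b ->
  (qh_dist Omega (gamma a) (gamma b) <= qh_length Omega gamma a b)%E.
Proof. by move=> rg; apply: ereal_inf_lbound; exists gamma, a, b. Qed.

(** Joins two curves after reparametrizing the second one to start where the
    first one ends. *)
Lemma qh_dist_triangle_length x y z gamma eta a b c d :
  rectifiable_curve_in Omega gamma a b -> gamma a = x -> gamma b = y ->
  rectifiable_curve_in Omega eta c d -> eta c = y -> eta d = z ->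
  (qh_dist Omega x z <= qh_length Omega gamma a b + qh_length Omega eta c d)%E.
Proof.
move=> rg gx gy re ey ez; pose h := c - b.
have [bh dh] : c = b + h /\ d = d - h + h by rewrite /h; split; ring.
have re' : rectifiable_curve_in Omega eta (b + h) (d - h + h) by rewrite -bh -dh.
have rs := rectifiable_shift re'.
have ge : gamma b = eta (b + h) by rewrite -bh gy ey.
have rgl := rectifiable_glue ge rg rs.
have [ab _ _ _] := rg; have [bd _ _ _] := rs.
have ac := le_trans ab bd.
have -> : x = glue gamma (fun t => eta (t + h)) b a by rewrite /glue ab.
have -> : z = glue gamma (fun t => eta (t + h)) b (d - h).
  by rewrite -(@glue_right _ _ _ (d - h))// ?subrK// in_itv/= bd lexx.
apply: le_trans (qh_dist_le_length rgl) _.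
have [_ cgl _ _] := rgl.
apply: le_trans (qh_length_cat _ ab bd cgl (rectifiable_fin rgl)) _.
rewrite -(eq_qh_length _ ab (@glue_left gamma (fun t => eta (t + h)) a b)
  (rectifiable_fin rg)).
rewrite -(eq_qh_length _ bd
  (fun t => @glue_right gamma (fun t => eta (t + h)) b (d - h) t ge)
  (rectifiable_fin rs)).
by rewrite qh_length_shift -?dh -?bh//; exact: rectifiable_fin.
Qed.

Lemma qh_dist_triangle x y z :
  (qh_dist Omega x z <= qh_dist Omega x y + qh_dist Omega y z)%E.
Proof.
have [xyoo|xyoo] := eqVneq (qh_dist Omega x y) +oo%E.
  by rewrite xyoo addye ?leey// -ltNye (lt_le_trans _ (qh_dist_ge0 _ _)).
have xyf : qh_dist Omega x y \is a fin_num.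
  by rewrite ge0_fin_numE ?qh_dist_ge0// lt_neqAle xyoo leey.
rewrite -leeBlDl//; apply: le_ereal_inf_tmp => _ [eta [c [d [re ey ez ->]]]].
rewrite leeBlDl// addeC.
have [->|eoo] := eqVneq (qh_length Omega eta c d) +oo%E.
  by rewrite addye ?leey// -ltNye (lt_le_trans _ (qh_dist_ge0 _ _)).
have ef : qh_length Omega eta c d \is a fin_num.
  by rewrite ge0_fin_numE ?qh_length_ge0// lt_neqAle eoo leey.
rewrite -leeBlDl//; apply: le_ereal_inf_tmp => _ [gamma [a [b [rg gx gy ->]]]].
by rewrite leeBlDl// addeC; exact: qh_dist_triangle_length re ey ez.
Qed.

(** The reason why the quasihyperbolic metric blows up at the boundary. *)
Lemma qh_dist_ge_ln x y : open Omega -> euc_boundary Omega !=set0 ->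
  Omega x -> Omega y ->
  ((ln (delta Omega x / delta Omega y))%:E <= qh_dist Omega x y)%E.
Proof.
move=> oO b0 Ox Oy; apply: le_ereal_inf_tmp => _ [gamma [a [b [rg gx gy ->]]]].
have [ab cg Og _] := rg.
rewrite -gx -gy; apply: qh_length_ge_ln => //.
- exact: rectifiable_fin rg.
- by move=> t /Og; exact: delta_gt0.
Qed.

Lemma qh_dist_segment x y (C : R) :
  (forall t, t \in `[0, 1] -> Omega (x + t *: (y - x))) ->
  (forall t, t \in `[0, 1] -> (delta Omega (x + t *: (y - x)))^-1 <= C) ->
  (qh_dist Omega x y <= (C * enorm (y - x))%:E)%E.
Proof.
move=> Oxy dC; pose gamma (t : R) := x + t *: (y - x).
have Lle := curve_length_line x (y - x) (@ler01 R).
rewrite subr0 mul1r in Lle.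
have cg : {within `[0, 1], continuous gamma}.
  apply: continuous_subspaceT => t; apply: cvgD; first exact: cvg_cst.
  by apply: cvgZr_tmp; exact: cvg_id.
have rg : rectifiable_curve_in Omega gamma 0 1.
  by split => //; apply: le_lt_trans Lle _; rewrite ltry.
have C0 : 0 <= C.
  by apply: le_trans (dC 0 _); rewrite ?invr_ge0 ?delta_ge0// in_itv/= lexx ler01.
have := qh_dist_le_length rg.
rewrite {1}/gamma scale0r addr0 {1}/gamma scale1r subrKC => /le_trans; apply.
apply: le_trans (qh_length_le ler01 cg (rectifiable_fin rg) dC) _.
by rewrite EFinM lee_wpmul2l.
Qed.

(** Near [x] the density is bounded, so a segment between nearby points has
    small quasihyperbolic length. Both orders of the arguments are
    recorded, so that symmetry of the distance need not be invoked. *)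
Lemma near_qh_dist_lt x (e : R) : open Omega -> Omega x -> 0 < e ->
  \forall y \near x, [/\ Omega y, (qh_dist Omega x y < e%:E)%E &
                        (qh_dist Omega y x < e%:E)%E].
Proof.
move=> oO Ox e0; have [r r0 [xrO dr]] := near_delta_inv_bound oO Ox.
have seg y z t : ball x r y -> ball x r z -> t \in `[0, 1] ->
    ball x r (y + t *: (z - y)).
  rewrite -ball_normE/= in_itv/= => xy xz /andP[t0 t1].
  have -> : x - (y + t *: (z - y)) = (1 - t) *: (x - y) + t *: (x - z).
    by apply/rowP => i; rewrite !mxE; ring.
  apply: le_lt_trans (ler_normD _ _) _; rewrite !normrZ.
  rewrite (ger0_norm t0) ger0_norm ?subr_ge0//.
  have [->|t0'] := eqVneq t 0; first by rewrite subr0 mul1r mul0r addr0.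
  have tp : 0 < t by rewrite lt_def t0' t0.
  have : t * `|x - z| < t * r by rewrite ltr_pM2l.
  have : (1 - t) * `|x - y| <= (1 - t) * r by rewrite ler_wpM2l ?subr_ge0// ltW.
  by lra.
have re0 : 0 < r * e by rewrite mulr_gt0.
have nb : nbhs x (ball x r) by exact: nbhsx_ballx.
apply: filterS2 nb (near_enorm_lt x re0) => y xy xye.
have xx : ball x r x by exact: ballxx.
have bound : ((r^-1 * enorm (x - y))%:E < e%:E)%E by rewrite lte_fin ltr_pdivrMl.
split; first exact: xrO.
  apply: le_lt_trans bound; rewrite enormB; apply: qh_dist_segment => t t01.
    by apply: xrO; exact: seg.
  by apply: dr; exact: seg.
apply: le_lt_trans bound; apply: qh_dist_segment => t t01.
  by apply: xrO; exact: seg.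
by apply: dr; exact: seg.
Qed.

(** Points at finite distance from [x] and points at infinite distance both form
    open sets, by the triangle inequality and the local bound. *)
Lemma qh_dist_fin x y : open Omega -> connected Omega -> Omega x -> Omega y ->
  (qh_dist Omega x y < +oo)%E.
Proof.
move=> oO cO Ox Oy; pose B := [set z | Omega z /\ (qh_dist Omega x z < +oo)%E].
pose C := [set z | Omega z /\ qh_dist Omega x z = +oo%E].
have oB : open B.
  rewrite openE => z [Oz xz].
  apply: filterS (near_qh_dist_lt oO Oz ltr01) => w [Ow zw _].
  split => //; apply: le_lt_trans (qh_dist_triangle x z w) _.
  by rewrite lte_add_pinfty// (lt_trans zw)// ltry.
have oC : open C.
  rewrite openE => z [Oz xz].
  apply: filterS (near_qh_dist_lt oO Oz ltr01) => w [Ow _ wz].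
  split => //; apply/eqP; apply/negPn/negP => xw.
  suff : (qh_dist Omega x z < +oo)%E by rewrite xz.
  apply: le_lt_trans (qh_dist_triangle x w z) _.
  by rewrite lte_add_pinfty// ?(lt_trans wz)// ?ltry// lt_neqAle xw leey.
suff BE : B = Omega by have [] : B y by rewrite BE.
apply: cO.
- exists x; split => //.
  have [_ /lt_trans + _] := nbhs_singleton (near_qh_dist_lt oO Ox ltr01).
  by apply; rewrite ltry.
- exists B => //; apply/seteqP; split => [z Bz|z [//]]; split => //; exact: Bz.1.
- exists (~` C); first exact: open_closedC.
  apply/seteqP; split => [z [Oz xz]|z [Oz zC]]; split => //.
    by move=> [_ xz']; rewrite xz' in xz.
  by rewrite lt_neqAle leey andbT; apply/eqP => xz; apply: zC.
Qed.

End qh_dist.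

(** * Limits of points and of geodesic lines in a bounded domain *)

Section bounded_domain.
Context {R : realType} {n : nat}.
Variable Omega : set 'rV[R]_n.
Hypothesis domO : bounded_domain Omega.
Implicit Types (x y z p q : 'rV[R]_n) (t : R).

Let oO : open Omega. Proof. by case: domO. Qed.

Let k_fin x y : Omega x -> Omega y -> (qh_dist Omega x y < +oo)%E.
Proof. by case: domO => ? ? _ _ _; exact: qh_dist_fin. Qed.

(** A point of the closure beyond the bound [N] would have a neighbour in the
    domain beyond the bound as well. *)
Lemma compact_closure_domain : compact (closure Omega).
Proof.
apply: bounded_closed_compact; last exact: closed_closure.
have [_ _ _ _ [M [Mreal OM]]] := domO; exists M; split => // N MN y cy.
rewrite /= leNgt; apply/negP => Ny.
have e0 : 0 < `|y| - N by rewrite subr_gt0.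
have [x [Ox]] := cy _ (nbhsx_ballx y _ e0).
rewrite -ball_normE/= => yx.
have : `|x| <= N by exact: OM Ox.
have := ler_normD (y - x) x; rewrite subrK; lra.
Qed.

(** Were [p] on the boundary, [delta] would tend to 0 along [u], against the
    logarithmic lower bound on the distance from [x0]. *)
Lemma qh_bounded_limit T (F : set_system T) (u : T -> 'rV[R]_n) x0 p (M : R) :
  ProperFilter F -> Omega x0 -> u @ F --> p ->
  (\forall k \near F, Omega (u k) /\ (qh_dist Omega x0 (u k) <= M%:E)%E) ->
  Omega p.
Proof.
move=> FF Ox0 up uM; apply: contrapT => nOp.
have bp : euc_boundary Omega p.
  rewrite euc_boundary_open//; split => // A /up FA.
  by have [k [[Ouk _] Auk]] := filter_ex (filterI uM FA); exists (u k).
have b0 : euc_boundary Omega !=set0 by exists p.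
have d0 := delta_gt0 oO b0 Ox0.
pose e := delta Omega x0 / expR M.
have e0 : 0 < e by rewrite divr_gt0// expR_gt0.
have [k [[Ou uMk] pue]] := filter_ex (filterI uM (up _ (near_enorm_lt p e0))).
have du0 := delta_gt0 oO b0 Ou.
have : delta Omega (u k) < e.
  by apply: le_lt_trans (delta_le _ bp) _; rewrite enormB.
apply/negP; rewrite -leNgt ler_pdivrMr ?expR_gt0//.
have := le_trans (qh_dist_ge_ln oO b0 Ox0 Ou) uMk.
rewrite lee_fin -ler_expR lnK ?posrE ?divr_gt0// ler_pdivrMr//.
by rewrite mulrC.
Qed.

(** Properness of the metric, in the form of an ultrafilter criterion. *)
Lemma qh_bounded_ultra_cvg T (F : set_system T) (u : T -> 'rV[R]_n) x0 (M : R) :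
  UltraFilter F -> Omega x0 ->
  (\forall k \near F, Omega (u k) /\ (qh_dist Omega x0 (u k) <= M%:E)%E) ->
  exists2 z, Omega z & u @ F --> z.
Proof.
move=> FU Ox0 uM.
have uO : (u @ F) (closure Omega).
  by apply: filterS uM => k [Ouk _]; exact: subset_closure.
have [z [_ clz]] := compact_closure_domain _ uO.
have uz : u @ F --> z.
  move=> A Az; have [//|FnA] := in_ultra_setVsetC (u @^-1` A) FU.
  by have [w [nAw Aw]] := clz _ _ (FnA : (u @ F) (~` A)) Az.
by exists z => //; exact: qh_bounded_limit Ox0 uz uM.
Qed.

Lemma cvg_near_qh_dist_lt T (F : set_system T) (u : T -> 'rV[R]_n) x (e : R) :
  Filter F -> Omega x -> u @ F --> x -> 0 < e ->
  \forall k \near F, [/\ Omega (u k), (qh_dist Omega x (u k) < e%:E)%E &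
                         (qh_dist Omega (u k) x < e%:E)%E].
Proof. by move=> FF Ox ux e0; exact: ux _ (near_qh_dist_lt oO Ox e0). Qed.

Lemma qh_dist_cvg T (F : set_system T) (u v : T -> 'rV[R]_n) x y (d : R) :
  ProperFilter F -> Omega x -> Omega y -> u @ F --> x -> v @ F --> y ->
  (\forall k \near F, qh_dist Omega (u k) (v k) = d%:E) ->
  qh_dist Omega x y = d%:E.
Proof.
move=> FF Ox Oy ux vy uvd.
have close (e : R) : 0 < e -> exists k, [/\ qh_dist Omega (u k) (v k) = d%:E,
    (qh_dist Omega x (u k) < (e / 2)%:E /\
     qh_dist Omega (u k) x < (e / 2)%:E)%E &
    (qh_dist Omega y (v k) < (e / 2)%:E /\
     qh_dist Omega (v k) y < (e / 2)%:E)%E].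
  move=> e0; have e20 : 0 < e / 2 by rewrite divr_gt0.
  have [k [[_ xu ux'] [[_ yv vy'] duv]]] := filter_ex (filterI
    (cvg_near_qh_dist_lt _ Ox ux e20)
    (filterI (cvg_near_qh_dist_lt _ Oy vy e20) uvd)).
  by exists k.
apply/eqP; rewrite eq_le; apply/andP; split;
  apply/lee_addgt0Pr => e /close[k [duv [xu ux'] [yv vy']]].
- apply: le_trans (qh_dist_triangle _ _ (u k) _) _.
  apply: (@le_trans _ _ ((e / 2)%:E + (d%:E + (e / 2)%:E))%E); last first.
    by rewrite -!EFinD lee_fin; lra.
  apply: leeD; first exact: ltW.
  apply: le_trans (qh_dist_triangle _ _ (v k) _) _.
  by rewrite duv leeD2l// ltW.
- rewrite -duv; apply: le_trans (qh_dist_triangle _ _ x _) _.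
  apply: (@le_trans _ _
    ((e / 2)%:E + (qh_dist Omega x y + (e / 2)%:E))%E); last first.
    by rewrite addeCA -EFinD -splitr.
  apply: leeD; first exact: ltW.
  apply: le_trans (qh_dist_triangle _ _ y _) _.
  by rewrite leeD2l// ltW.
Qed.

Lemma compact_qh_bounded x (K : set 'rV[R]_n) : compact K -> K `<=` Omega ->
  Omega x -> exists M : R, forall w, K w -> (qh_dist Omega x w <= M%:E)%E.
Proof.
move=> cK KO Ox.
have /compact_near_coveringP/(_ R +oo%R
  (fun M w => (qh_dist Omega x w <= M%:E)%E)) := cK.
case=> [w Kw|M [Mr MK]].
  have Ow := KO _ Kw.
  have xwf : qh_dist Omega x w \is a fin_num.
    by rewrite ge0_fin_numE ?qh_dist_ge0// k_fin.
  pose B := [set M : R | fine (qh_dist Omega x w) + 1 <= M].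
  have Boo : \forall M \near +oo, B M by apply: nbhs_pinfty_ge; exact: num_real.
  exists ([set w' | (qh_dist Omega w w' < 1%:E)%E], B).
    split => //; apply: filterS (near_qh_dist_lt oO Ow ltr01) => ? [//].
  move=> [w' M] /= [ww' wM].
  apply: le_trans (qh_dist_triangle _ _ w _) _.
  apply: (@le_trans _ _ (fine (qh_dist Omega x w) + 1)%:E); last by rewrite lee_fin.
  by rewrite EFinD fineK// leeD2l// ltW.
by exists (M + 1); apply: MK; rewrite ltrDl.
Qed.

(** Near a point of the domain distances are bounded, whereas a geodesic line
    moves arbitrarily far from its origin. *)
Lemma line_limit_notin T (F : set_system T) gamma (t : T -> R) q :
  ProperFilter F -> qh_geodesic_line Omega gamma ->
  (forall A : R, \forall k \near F, A <= `|t k|) ->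
  gamma (t k) @[k --> F] --> q -> ~ Omega q.
Proof.
move=> FF [Og dg] toO gq Oq.
have qf : qh_dist Omega (gamma 0) q \is a fin_num.
  by rewrite ge0_fin_numE ?qh_dist_ge0// k_fin.
have [k [tk [_ qg _]]] := filter_ex (filterI
  (toO (fine (qh_dist Omega (gamma 0) q) + 1))
  (cvg_near_qh_dist_lt _ Oq gq ltr01)).
have : (`|0 - t k|%:E < qh_dist Omega (gamma 0%R) q + 1%:E)%E.
  rewrite -dg; apply: le_lt_trans (qh_dist_triangle _ _ q _) _.
  by rewrite lteD2lE.
by rewrite -(fineK qf) -EFinD lte_fin sub0r normrN ltNge tk.
Qed.

Lemma limit_set_pinfty_boundary gamma : qh_geodesic_line Omega gamma ->
  limit_set_pinfty Omega gamma `<=` euc_boundary Omega.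
Proof.
move=> gl q [cq [t too gq]]; rewrite euc_boundary_open//; split => //.
apply: (line_limit_notin _ gl _ gq) => A.
have /cvgryPge/(_ A) := too.
by apply: filterS => k /le_trans; apply; exact: ler_norm.
Qed.

(** A cluster point at infinity, turned into a sequential limit. *)
Lemma limit_set_pinfty_neq0 gamma : (forall t, Omega (gamma t)) ->
  limit_set_pinfty Omega gamma !=set0.
Proof.
move=> Og.
have gO : \forall t \near +oo, closure Omega (gamma t).
  by apply: filterE => t; exact/subset_closure/Og.
have [p [cp clp]] := compact_closure_domain _
  (gO : (gamma @ +oo) (closure Omega)).
have tk k : exists t : R, k%:R <= t /\ ball p k.+1%:R^-1 (gamma t).
  have k0 : 0 < k.+1%:R^-1 :> R by rewrite invr_gt0 ltr0n.
  have gk : (gamma @ +oo) (gamma @` [set t | k%:R <= t]).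
    have : \forall t \near +oo, k%:R <= t :> R.
      by apply: nbhs_pinfty_ge; exact: num_real.
    by apply: filterS => t kt; exists t.
  by have [_ [[t kt <-] pt]] := clp _ _ gk (nbhsx_ballx p _ k0); exists t.
have [t tP] := choice tk.
exists p; split => //; exists t.
  apply/cvgryPge => A; near=> k; apply: le_trans (tP k).1.
  by near: k; exact: nbhs_infty_ger.
move=> A /nbhs_ballP[e /= e0 eA].
suff : \forall k \near \oo, A (gamma (t k)) by [].
near=> k; apply: eA; have [_] := tP k; apply: le_ball; apply: ltW.
by near: k; apply: near_infty_natSinv_lt (PosNum e0).
Unshelve. all: by end_near. Qed.

End bounded_domain.

Section line_reversal.
Context {R : realType} {n : nat}.
Variable Omega : set 'rV[R]_n.
Implicit Types gamma : R -> 'rV[R]_n.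

Lemma qh_geodesic_line_opp gamma : qh_geodesic_line Omega gamma ->
  qh_geodesic_line Omega (gamma \o -%R).
Proof.
move=> [Og dg]; split => [s|s t]; first exact: Og.
by rewrite /= dg opprK addrC distrC.
Qed.

(** Both ends of a line can thus be handled by statements about [+oo]. *)
Lemma limit_set_ninftyE gamma :
  limit_set_ninfty Omega gamma = limit_set_pinfty Omega (gamma \o -%R).
Proof.
apply/seteqP; split => q [cq [t too gq]]; split => //; exists (\- t).
- exact/cvgNry.
- rewrite (_ : (fun k => _) = gamma \o t)//.
  by apply/funext => k /=; rewrite opprK.
- exact/cvgNrNy.
- by [].
Qed.

End line_reversal.

(** * Visibility, good behaviour and loops *)

Section visibility.
Context {R : realType} {n : nat}.
Variable Omega : set 'rV[R]_n.
Implicit Types (x y z p q : 'rV[R]_n) (t : R).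

Lemma qh_geodesic_sub gamma (a b c d : R) : a <= c -> c <= d -> d <= b ->
  qh_geodesic Omega gamma a b -> qh_geodesic Omega gamma c d.
Proof.
move=> ac cd db [_ Og dg].
have sub t : t \in `[c, d] -> t \in `[a, b].
  by rewrite !in_itv/= => /andP[ct td]; rewrite (le_trans ac ct) (le_trans td db).
split => // [t /sub|s t /sub sab /sub tab]; [exact: Og|exact: dg].
Qed.

Lemma qh_geodesic_shift gamma (h a b : R) :
  qh_geodesic Omega gamma (a + h) (b + h) ->
  qh_geodesic Omega (fun t => gamma (t + h)) a b.
Proof.
move=> [ab Og dg]; have sub t : t \in `[a, b] -> t + h \in `[a + h, b + h].
  by rewrite !in_itv/= !lerD2r.
split => [|t /sub|s t /sub sab /sub tab]; [by move: ab; rewrite lerD2r|exact: Og|].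
by rewrite dg// opprD addrACA subrr addr0.
Qed.

Lemma qh_geodesic_opp gamma (a b : R) :
  qh_geodesic Omega gamma (- b) (- a) -> qh_geodesic Omega (gamma \o -%R) a b.
Proof.
move=> [ab Og dg]; have sub t : t \in `[a, b] -> - t \in `[- b, - a].
  by rewrite !in_itv/= !lerN2 andbC.
split => [|t /sub|s t /sub sab /sub tab]; [by move: ab; rewrite lerN2|exact: Og|].
by rewrite /= dg// opprK addrC distrC.
Qed.

(** If the line had a limit point [q] other than [p], visibility would give a
    compact set [K] met by the geodesic [eta k] between the time [t j], when it
    is near [q], and its end, near [p]. The meeting point is at distance at
    least [t j] from [eta k 0], hence far from [gamma 0] when [j] is large,
    whereas [K] is bounded. *)
Lemma visible_limit_end T (F : set_system T) (eta : T -> R -> 'rV[R]_n)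
    (beta : T -> R) gamma p :
  ProperFilter F -> qh_visibility_domain Omega -> euc_boundary Omega p ->
  (forall A : R, \forall k \near F, A <= beta k) ->
  (\forall k \near F, qh_geodesic Omega (eta k) 0 (beta k)) ->
  eta k (beta k) @[k --> F] --> p ->
  qh_geodesic_line Omega gamma ->
  (forall t, 0 <= t -> eta k t @[k --> F] --> gamma t) ->
  limit_set_pinfty Omega gamma = [set p].
Proof.
move=> FF [domO visO] bp boo geta etap gl etag.
have [oO _ _ _ _] := domO.
have [q0 Gq0] := limit_set_pinfty_neq0 domO gl.1.
suff sub : limit_set_pinfty Omega gamma `<=` [set p].
  by apply/seteqP; split => // _ ->; rewrite -(sub _ Gq0).
move=> q Gq; apply: contrapT => qp.
have bq := limit_set_pinfty_boundary domO gl Gq.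
have [_ [t too gq]] := Gq.
have [U [V [K [nU nV _ [cK KO] visK]]]] := visO q p bq bp qp.
have [M KM] := compact_qh_bounded domO cK KO (gl.1 0).
have nUj : \forall j \near \oo, U° (gamma (t j)) := gq _ (nbhs_interior nU).
have [j [tM Uj]] := filter_ex (filterI
  ((cvgryPge _).1 too (Num.max 0 (M + 1 + 1))) nUj).
(* one unit for the distance from [eta k 0] to [gamma 0], one for strictness *)
have [tj0 tjM] : 0 <= t j /\ M + 1 < t j.
  by move: tM; rewrite ge_max => /andP[t0 Mt]; split => //; lra.
have nUk : \forall k \near F, U (eta k (t j)) := etag _ tj0 _ Uj.
have nVk : \forall k \near F, V (eta k (beta k)) := etap _ nV.
have n0k : \forall k \near F, _ :=
  cvg_near_qh_dist_lt domO FF (gl.1 0) (etag 0 (lexx 0)) ltr01.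
have [k [[Uk Vk] [bk [gk [_ g0k g0k']]]]] := filter_ex (filterI
  (filterI nUk nVk) (filterI (boo (t j)) (filterI geta n0k))).
have gs : qh_geodesic Omega (fun s => eta k (s + t j)) 0 (beta k - t j).
  apply: qh_geodesic_shift; rewrite add0r subrK.
  by apply: qh_geodesic_sub gk.
have [] := visK _ _ gs.
- by rewrite add0r; exact: Uk.
- by rewrite subrK; exact: Vk.
move=> _ [[s + <-] Kw]; rewrite /= in_itv/= => /andP[s0 sb].
have [_ _ dk] := gk.
have d0s : qh_dist Omega (eta k 0) (eta k (s + t j)) = (s + t j)%:E.
  have st0 : 0 <= s + t j by rewrite addr_ge0.
  have stb : s + t j <= beta k by rewrite -lerBrDr.
  rewrite dk ?in_itv/= ?lexx ?st0 ?(le_trans st0 stb)//.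
  by rewrite sub0r normrN ger0_norm.
have := qh_dist_triangle Omega (eta k 0) (gamma 0) (eta k (s + t j)).
rewrite d0s; apply/negP; rewrite -ltNge.
apply: (@le_lt_trans _ _ (1%:E + M%:E)%E).
  by apply: leeD; [exact: ltW|exact: KM].
by rewrite -EFinD lte_fin; lra.
Qed.

(** A loop supplies arbitrarily long subarcs, all through [gamma 0], whose two
    end points tend to a common boundary point. *)
Lemma qh_well_behaved_no_loop : bounded_domain Omega ->
  qh_well_behaved Omega -> no_geodesic_loop Omega.
Proof.
move=> domO wb gamma [gl loop].
have [oO cO _ _ _] := domO; have [Og dg] := gl.
have [p Gp] := limit_set_pinfty_neq0 domO Og.
have bp := limit_set_pinfty_boundary domO gl Gp.
have [_ [t too gt]] := Gp.
have [_ [s sNoo gs]] : limit_set_ninfty Omega gamma p by rewrite -loop.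
have [N _ stN] : \forall k \near \oo, s k <= 0 <= t k.
  by apply: filterS2 ((cvgrNyPle _).1 sNoo 0) ((cvgryPge _).1 too 0) => k -> ->.
have st0 k : s (k + N)%N <= 0 <= t (k + N)%N by apply: stN; rewrite /= leq_addl.
have [] := wb (fun k => gamma (s (k + N)%N)) (fun k => gamma (t (k + N)%N)) p
  (fun k => s (k + N)%N) (fun k => t (k + N)%N) (fun=> gamma).
- by move=> k; exact: Og.
- by move=> k; exact: Og.
- exact: bp.
- move=> C /gs Cs; exact: (cvg_addnr N _ Cs).
- move=> C /gt Ct; exact: (cvg_addnr N _ Ct).
- move=> k; split=> [|//|//]; split=> [|u _|u v _ _]; [|exact: Og|exact: dg].
  by have /andP[s0 t0] := st0 k; exact: le_trans t0.
move=> x0 Ox0 /cvgeyPge.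
have x0f : qh_dist Omega x0 (gamma 0) \is a fin_num.
  by rewrite ge0_fin_numE ?qh_dist_ge0// qh_dist_fin.
move=> /(_ (fine (qh_dist Omega x0 (gamma 0)) + 1)) /filter_ex[k].
apply/negP; rewrite -ltNge.
apply: (@le_lt_trans _ _ (qh_dist Omega x0 (gamma 0))).
  by apply: ereal_inf_lbound; exists 0%R => //=; rewrite in_itv/= st0.
by rewrite -[ltLHS]fineK// lte_fin ltrDl.
Qed.

(** Geodesics that return to a bounded set infinitely often, recentred at such
    a return, have a limit along an ultrafilter; this limit is a geodesic line
    and visibility forces both its ends to be [p]. *)
Lemma no_loop_qh_well_behaved : qh_visibility_domain Omega ->
  no_geodesic_loop Omega -> qh_well_behaved Omega.
Proof.
move=> vis noloop x y p a b g Ox Oy bp xp yp gP.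
have [domO _] := vis; have [oO _ [x0 Ox0] _ _] := domO.
have nOp : ~ Omega p by move: bp; rewrite euc_boundary_open// => -[].
exists x0 => //; apply/cvgeyPge => A; apply: contrapT => notA.
(* [S] collects the geodesics that come back within distance [A] of [x0] *)
pose S := [set k | (qh_dist_curve Omega x0 (g k) (a k) (b k) < A%:E)%E].
have PF : ProperFilter (within S \oo).
  split; last exact: within_filter.
  move=> S0; apply: notA.
  have {}S0 : \forall k \near \oo, S k -> False := S0.
  apply: filterS S0 => k kS.
  by rewrite leNgt; apply/negP => /kS.
have [F [FU sF]] := ultraFilterLemma PF.
have FF : ProperFilter F by exact: ultra_proper.
have FS : F S by apply: sF; exact: withinT.
have Foo (P : set nat) : (\forall k \near \oo, P k) -> F P.
  by move=> nP; apply: sF; exact: cvg_within nP.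
have /choice[c cP] : forall k, exists c, S k ->
    c \in `[a k, b k] /\ (qh_dist Omega x0 (g k c) < A%:E)%E.
  move=> k; have [|nS] := pselect (S k); last by exists 0.
  by move=> /ereal_inf_lt[_ [c cab <-] cA]; exists c.
have Fgeo : \forall k \near F, [/\ a k <= c k, c k <= b k &
    (qh_dist Omega x0 (g k (c k)) <= A%:E)%E].
  apply: filterS FS => k /cP[+ cA]; rewrite in_itv/= => /andP[ac cb].
  by split => //; exact: ltW.
have gO k u : a k <= u -> u <= b k -> Omega (g k u).
  by move=> au ub; have [[_ + _] _ _] := gP k; apply; rewrite in_itv/= au.
have gd k u v : a k <= u -> u <= b k -> a k <= v -> v <= b k ->
    qh_dist Omega (g k u) (g k v) = `|u - v|%:E.
  by move=> au ub av vb; have [[_ _ +] _ _] := gP k; apply; rewrite in_itv/= ?au ?av.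
(* as [g k (e k)] tends to the boundary, its distance from [x0] cannot stay
   bounded on a set of the ultrafilter *)
have Fend (e : nat -> R) : (forall k, a k <= e k /\ e k <= b k) ->
    g k (e k) @[k --> \oo] --> p ->
    forall B, \forall k \near F, B <= `|c k - e k|.
  move=> eab ep B.
  have [//|Flt] := in_ultra_setVsetC [set k | B <= `|c k - e k|] FU.
  exfalso; apply: nOp; apply: (@qh_bounded_limit _ _ _ domO _ F
    (fun k => g k (e k)) x0 p (A + B)) => //.
    by move=> C Cp; apply: Foo; exact: ep.
  apply: filterS2 Fgeo Flt => k [ac cb cA] /negP; rewrite -ltNge => ceB.
  have [ae eb] := eab k; split; first exact: gO.
  apply: le_trans (qh_dist_triangle _ _ (g k (c k)) _) _.
  by rewrite EFinD leeD// gd// lee_fin ltW.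
have ab k : a k <= b k by have [[]] := gP k.
have Fb B : \forall k \near F, B <= b k - c k.
  have : g k (b k) @[k --> \oo] --> p.
    by rewrite (_ : (fun k => _) = y)//; apply/funext => k; have [] := gP k.
  move=> /(Fend b)-/(_ (fun k => conj (ab k) (lexx _)) B).
  by apply: filterS2 Fgeo => k [_ cb _]; rewrite distrC ger0_norm// subr_ge0.
have Fa B : \forall k \near F, B <= c k - a k.
  have : g k (a k) @[k --> \oo] --> p.
    by rewrite (_ : (fun k => _) = x)//; apply/funext => k; have [] := gP k.
  move=> /(Fend a)-/(_ (fun k => conj (lexx _) (ab k)) B).
  by apply: filterS2 Fgeo => k [ac _ _]; rewrite ger0_norm// subr_ge0.
have Fab t : \forall k \near F, a k <= t + c k /\ t + c k <= b k.
  apply: filterS2 (Fa (- t)) (Fb t) => k Hta Htb; split; lra.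
have /choice[gamma gammaP] : forall t, exists z, Omega z /\
    g k (t + c k) @[k --> F] --> z.
  move=> t; have [|z Oz tz] := @qh_bounded_ultra_cvg _ _ _ domO _ F
    (fun k => g k (t + c k)) x0 (A + `|t|) FU Ox0; last by exists z.
  apply: filterS2 Fgeo (Fab t) => k [ac cb cA] [atc tcb].
  split; first exact: gO.
  apply: le_trans (qh_dist_triangle _ _ (g k (c k)) _) _.
  by rewrite EFinD leeD// gd// lee_fin opprD addrC subrK normrN.
have gl : qh_geodesic_line Omega gamma.
  split => [t|s t]; first exact: (gammaP t).1.
  apply: (qh_dist_cvg domO FF (gammaP s).1 (gammaP t).1 (gammaP s).2 (gammaP t).2).
  apply: filterS2 (Fab s) (Fab t) => k [? ?] [? ?]; rewrite gd//.
  by rewrite opprD addrACA subrr addr0.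
apply: (noloop gamma); split => //; rewrite limit_set_ninftyE.
rewrite (@visible_limit_end _ F (fun k t => g k (t + c k))
  (fun k => b k - c k) _ p)//.
- rewrite (@visible_limit_end _ F (fun k t => g k (- t + c k))
    (fun k => c k - a k) _ p)//.
  + apply: filterS Fgeo => k [ac cb _].
    apply: (@qh_geodesic_opp (fun t => g k (t + c k))); apply: qh_geodesic_shift.
    have [gk _ _] := gP k; rewrite oppr0 add0r opprB subrK.
    exact: qh_geodesic_sub gk.
  + move=> C /xp Cx; apply: Foo.
    have {}Cx : \forall k \near \oo, C (x k) := Cx.
    by apply: filterS Cx => k; rewrite /= opprB subrK; have [_ -> _] := gP k.
  + exact: qh_geodesic_line_opp.
  + by move=> t _; exact: (gammaP (- t)).2.
- apply: filterS Fgeo => k [ac cb _]; apply: qh_geodesic_shift.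
  have [gk _ _] := gP k; rewrite add0r subrK.
  exact: qh_geodesic_sub gk.
- move=> C /yp Cy; apply: Foo.
  have {}Cy : \forall k \near \oo, C (y k) := Cy.
  by apply: filterS Cy => k; rewrite /= subrK; have [_ _ ->] := gP k.
- by move=> t _; exact: (gammaP t).2.
Qed.

End visibility.

Theorem proposition2p3 (R : realType) (n : nat) (Omega : set 'rV[R]_n)
  (hOmega : qh_visibility_domain Omega) :
  qh_well_behaved Omega <-> no_geodesic_loop Omega.
Proof.
split; first exact: qh_well_behaved_no_loop hOmega.1.
exact: no_loop_qh_well_behaved.
Qed.
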